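(* Suppose that $\psi$ is a locally absolutely continuous function on $\mathbb{R}_+=(0,\infty)$ and that $Q_\psi\in\boldsymbol{S}_{1/2}$. Then $\psi=0$ everywhere on $\mathbb{R}_+$.
   Context: For a locally integrable complex-valued function $\psi$ on $\mathbb{R}_+=(0,\infty)$, the operator $Q_\psi$ is defined on bounded functions $f$ with compact support in $\mathbb{R}_+$ by $(Q_\psi f)(x)=\int_0^\infty\psi(\max\{x,y\})f(y)\,dy$. Writing $Q_\psi\in\boldsymbol{S}_{1/2}$ means that it extends to a bounded operator on $L^2(\mathbb{R}_+)$ with $\sum_{n\ge0}s_n(Q_\psi)^{1/2}<\infty$, where $s_n(T)=\inf\{\|T-R\|:\operatorname{rank}R\le n\}$. *)

(* Defs.v *)
From HB Require Import structures.
From mathcomp Require Import all_boot all_order all_algebra.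
From mathcomp Require Import all_classical all_reals all_analysis.
From mathcomp Require Import complex.

Set Implicit Arguments.
Unset Strict Implicit.
Unset Printing Implicit Defensive.

Import Order.TTheory GRing.Theory Num.Theory.
Import numFieldNormedType.Exports.
Import ComplexField.

Local Open Scope classical_set_scope.
Local Open Scope ring_scope.

Section Functions.
Context {R : realType}.
Implicit Types (f g psi : R -> R[i]) (K : set R).

Definition Rpos : set R := `]0, +oo[%classic.

Definition abs_continuous_on (a b : R) psi :=
  forall e : R, 0 < e -> exists2 d : R, 0 < d &
    forall (n : nat) (s t : 'I_n -> R),
      (forall i, [/\ a <= s i, s i <= t i & t i <= b]) ->
      trivIset [set: 'I_n] (fun i => `]s i, t i[%classic) ->
      \sum_(i < n) (t i - s i) < d ->
      \sum_(i < n) Normc.normc (psi (t i) - psi (s i)) < e.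

Definition locally_abs_continuous psi :=
  forall a b : R, 0 < a -> a < b -> abs_continuous_on a b psi.

(* Borel measurability; every Lebesgue class has a Borel representative. *)
Definition cmeasurable f :=
  measurable_fun Rpos (fun x => complex.Re (f x)) /\
  measurable_fun Rpos (fun x => complex.Im (f x)).

Definition cintegral f : R[i] :=
  Complex (\int[lebesgue_measure]_(x in Rpos) complex.Re (f x))
          (\int[lebesgue_measure]_(x in Rpos) complex.Im (f x)).

Definition ae_eq_pos f g := ae_eq lebesgue_measure Rpos f g.

Definition L2norm f : \bar R :=
  'N[lebesgue_measure]_(2%:E)[(fun x => (Normc.normc (f x))%:E) \_ Rpos].

Definition L2 f := cmeasurable f /\ (L2norm f < +oo)%E.

Definition bounded_compactly_supported f :=
  (exists M : R, forall x, Rpos x -> Normc.normc (f x) <= M) /\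
  (exists K, [/\ compact K, K `<=` Rpos &
     forall x, Rpos x -> ~ K x -> f x = 0]).

Definition Qop psi f : R -> R[i] :=
  fun x => cintegral (fun y => psi (Num.max x y) * f y).

End Functions.

Section Operators.
Context {R : realType}.
Implicit Types (T : (R -> R[i]) -> (R -> R[i])) (n : nat) (p : R).

(* An operator on the Hilbert space L^2(0, oo) is given by its action on
   representatives; only its values on [L2] matter, and only up to almost
   everywhere equality.  Linearity and the bound together imply that it
   respects almost everywhere equality. *)
Definition bounded_operator T :=
  [/\ forall f, L2 f -> L2 (T f),
      forall (c : R[i]) f g, L2 f -> L2 g ->
        ae_eq_pos (T (fun x => c * f x + g x))
                  (fun x => c * T f x + T g x) &
      exists M : R, forall f, L2 f -> (L2norm (T f) <= M%:E * L2norm f)%E].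

Definition opnorm T : \bar R :=
  ereal_sup [set L2norm (T f) | f in [set f | L2 f /\ (L2norm f <= 1)%E]].

Definition rank_le n T :=
  exists2 g : 'I_n -> R -> R[i], forall i, L2 (g i) &
    forall f, L2 f -> exists c : 'I_n -> R[i],
      ae_eq_pos (T f) (fun x => \sum_(i < n) c i * g i x).

Definition singular_number T n : \bar R :=
  ereal_inf [set opnorm (fun f x => T f x - S f x) |
             S in [set S | bounded_operator S /\ rank_le n S]].

Definition Schatten p T :=
  bounded_operator T /\
  (\sum_(0 <= n <oo) (singular_number T n `^ p) < +oo)%E.

Definition Q_extends_to (psi : R -> R[i]) T :=
  forall f, cmeasurable f -> bounded_compactly_supported f ->
    ae_eq_pos (T f) (Qop psi f).

Definition Q_in_Schatten p (psi : R -> R[i]) :=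
  exists2 T, Q_extends_to psi T & Schatten p T.

End Operators.

(* Main.v *)
Require Import Defs.
From mathcomp Require Import all_boot all_order all_algebra.
From mathcomp Require Import all_classical all_reals all_analysis.
From mathcomp Require Import complex.
From mathcomp Require Import measurable_realfun ring lra zify.

(** Why it holds.  Fix h > 0 and cut (0, oo) into cells [p, p + 4h].  On a cell
take the two pulses
  f = 1 on the first quarter, - 1 on the last quarter, and
  g = 1 on the second quarter, - 1 on the third one.
Both have mean zero, and the kernel psi(max(x, y)) depends only on the larger
variable.  Hence Q f is constant on every other cell, and on the middle half of
its own cell it equals h psi plus a constant.  So for pulses on disjoint cells
the matrix of the numbers (Q f_j, g_i) is diagonal, with entries h W_i, where
W_i is the difference of the integrals of psi over the two middle quarters of
the cell i.  As f and g have norm (2h)^(1/2), this diagonal structure gives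
s_n(Q) >= k as soon as n + 1 disjoint cells satisfy |W_i| >= 2k
([singular_number_ge]): an operator of rank n kills a combination of n + 1
pulses, and Q is bounded below by k on all these combinations.

If the s_j^(1/2) are summable and s_j >= k for all j <= n, then n^2 k is small
when n is large ([sqrt_summable_decay]).  Take k = eps h^2: on a
mesh of size h in [a, b], the number of disjoint cells with |W_i| >= 2 eps h^2
is o(1/h), so these bad cells have small total length
([few_large_second_differences]).

Now let the cells start at consecutive mesh points.  Then the W_i telescope, to
h (psi(a) - psi(b)) up to o(h).  The good cells contribute at most 2 eps h^2
each, that is O(eps h) together.  On a bad cell |W_i| is h times an increment
of psi over a length h, by the mean value theorem, so absolute continuity makes
the sum over the bad cells o(h).  Dividing by h gives psi(a) = psi(b)
([ac_rigidity]).  The argument is run for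
the real and the imaginary part.

Finally, if psi is a constant c, then Q maps the indicator of [1, 2] to c, which
is square integrable on (0, oo) only for c = 0 ([bounded_constant_eq0]). *)

Set Implicit Arguments.
Unset Strict Implicit.
Unset Printing Implicit Defensive.

Import Order.TTheory GRing.Theory Num.Theory.
Import numFieldNormedType.Exports.
Import ComplexField.

Local Open Scope classical_set_scope.
Local Open Scope ring_scope.

(** * Integrals of continuous functions over segments *)

Section IntervalIntegrals.
Context {R : realType}.
Implicit Types (u v : R -> R) (a b c s t x h : R).
Notation mu := (@lebesgue_measure R).

Definition itvint u s t := \int[mu]_(x in `[s, t]) u x.

Definition continuous_pos u := forall x, 0 < x -> {for x, continuous u}.

Lemma continuous_pos_within u s t : continuous_pos u -> 0 < s ->
  {within `[s, t], continuous u}.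
Proof.
move=> cu s0; apply: continuous_in_subspaceT => x.
rewrite inE/= in_itv/= => /andP[sx _]; apply: cu; exact: lt_le_trans sx.
Qed.

Lemma continuous_pos_integrable u s t : continuous_pos u -> 0 < s ->
  mu.-integrable `[s, t] (EFin \o u).
Proof.
move=> cu s0; apply: continuous_compact_integrable.
  exact: segment_compact.
exact: continuous_pos_within.
Qed.

Lemma itvint_cst c s t : s <= t -> itvint (fun=> c) s t = (t - s) * c.
Proof.
move=> st; rewrite /itvint Rintegral_cst//= lebesgue_measure_itv/= lte_fin.
rewrite mulrC; case: ltP => st'; first by rewrite -EFinD.
by have -> : t = s by [apply/le_anti/andP]; rewrite subrr !mul0r.
Qed.

Lemma itvint_split u s x t : continuous_pos u -> 0 < s -> s <= x -> x <= t ->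
  itvint u s t = itvint u s x + itvint u x t.
Proof.
move=> cu s0 sx xt; apply/eqP; rewrite addrC -subr_eq; apply/eqP.
rewrite /itvint Rintegral_itvB ?bnd_simp//; last exact: continuous_pos_integrable.
rewrite Rintegral_itv_obnd_cbnd//.
apply: (@integrableS _ _ _ mu `[x, t]) => //; first exact: subset_itv_oc_cc.
by apply: continuous_pos_integrable => //; exact: lt_le_trans sx.
Qed.

(** The mean value theorem for the sliding integral of [u] over a window of
    length [h], whose derivative is the increment of [u] over the window. *)
Lemma itvint_increment u a b h : continuous_pos u -> 0 < h -> 0 < a -> a < b ->
  exists2 x, a < x < b &
  itvint u b (b + h) - itvint u a (a + h) = (b - a) * (u (x + h) - u x).
Proof.
move=> cu h0 a0 ab.
(* Any base point of the primitive strictly between 0 and [a] would do. *)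
pose c := a / 2.
have c0 : 0 < c by rewrite divr_gt0.
have ca : c < a by rewrite /c; lra.
pose P y := itvint u c y.
have dP y : c < y -> is_derive y 1 P (u y).
  move=> cy.
  have [||||D E] := @continuous_FTC1_closed R u c y (y + 1).
  - by rewrite ltrDl.
  - exact: continuous_pos_integrable.
  - by [].
  - by apply: cu; lra.
  - by apply: DeriveDef; [exact: D|rewrite -derive1E].
pose K y := P (y + h) - P y.
have KE y : a <= y -> K y = itvint u y (y + h).
  by move=> ay; rewrite /K /P (@itvint_split _ c y)//; lra.
have dK y : y \in `]a, b[ -> is_derive y 1 K (u (y + h) - u y).
  rewrite in_itv/= => /andP[ay yb].
  have d1 : is_derive (y + h) 1 P (u (y + h)) by apply: dP; lra.
  have d2 : is_derive y 1 P (u y) by apply: dP; lra.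
  have d3 : is_derive y 1 (fun y => y + h) 1.
    by apply: is_derive_eq; rewrite addr0.
  have d4 := @is_derive1_comp _ P (fun y => y + h) y _ _ d1 d3.
  have -> : K = (P \o (fun y => y + h)) - P by apply/funext.
  have d5 := is_deriveB d4 d2.
  apply: (is_derive_eq d5).
  by rewrite mulr1.
have cK : {within `[a, b], continuous K}.
  apply: continuous_in_subspaceT => y; rewrite inE/= in_itv/= => /andP[ay yb].
  have cP z : c < z -> {for z, continuous P}.
    by move=> cz; apply/differentiable_continuous/derivable1_diffP; case: (dP z cz).
  have c1 : {for y, continuous (fun y => P (y + h))}.
    apply: (@continuous_comp _ _ _ (fun y => y + h) P).
      by apply: continuousD; [exact: cvg_id|exact: cvg_cst].
    by apply: cP; lra.
  have cPy : {for y, continuous P} by apply: cP; lra.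
  exact: continuousB c1 cPy.
have [x xab E] := MVT ab dK cK.
exists x; first by move: xab; rewrite in_itv.
by rewrite -KE ?ltW// -KE// E mulrC.
Qed.

(** Cauchy-Schwarz against the function equal to 1 on the first half of the
    segment and to - 1 on the second half.  It follows from the nonnegativity
    of the integrals of [(v - c) ^+ 2] and [(v + c) ^+ 2] over the halves, at
    the optimal [c]. *)
Lemma sqr_half_difference_le v s h : continuous_pos v -> 0 < s -> 0 < h ->
  (itvint v s (s + h) - itvint v (s + h) (s + h + h)) ^+ 2 <=
  (h + h) * itvint (fun x => v x ^+ 2) s (s + h + h).
Proof.
move=> cv s0 h0.
have csq w : continuous_pos w -> continuous_pos (fun x => w x ^+ 2).
  by move=> cw x x0; apply: continuousM; exact: cw.
have E c a : 0 < a -> itvint (fun x => (v x - c) ^+ 2) a (a + h) =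
    itvint (fun x => v x ^+ 2) a (a + h) - 2 * c * itvint v a (a + h) + h * c ^+ 2.
  move=> a0.
  have iv := continuous_pos_integrable (a + h) cv a0.
  have iv2 := continuous_pos_integrable (a + h) (csq _ cv) a0.
  have i1 : mu.-integrable `[a, a + h] (EFin \o (fun x => 2 * c * v x)).
    by apply: continuous_pos_integrable => // x x0; apply: continuousM;
      [exact: cvg_cst|exact: cv].
  have i2 : mu.-integrable `[a, a + h] (EFin \o (fun x => v x ^+ 2 - 2 * c * v x)).
    apply: continuous_pos_integrable => // x x0; apply: continuousB; first exact: csq.
    by apply: continuousM; [exact: cvg_cst|exact: cv].
  rewrite /itvint -(RintegralZl (2 * c) _ iv)//.
  rewrite -(RintegralB _ iv2 i1)//.
  have -> : h * c ^+ 2 = itvint (fun=> c ^+ 2) a (a + h).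
    by rewrite itvint_cst ?lerDl ?ltW// addrAC subrr add0r.
  rewrite /itvint -(RintegralD _ i2)//; last first.
    by apply: continuous_pos_integrable => // x x0; exact: cvg_cst.
  by apply: eq_Rintegral => x _; ring.
have P c a : 0 <= itvint (fun x => (v x - c) ^+ 2) a (a + h).
  by apply: Rintegral_ge0 => x _; exact: sqr_ge0.
set A := itvint v s _; set B := itvint v (s + h) _.
pose c := (A - B) / (h + h).
have s1 : 0 < s + h by lra.
have := P c s; rewrite E// -/A => P1.
have := P (- c) (s + h); rewrite E// -/B => P2.
rewrite (@itvint_split _ s (s + h))//; [|exact: csq|lra|lra].
move: P1 P2; move: (itvint _ s _) (itvint _ (s + h) _) => X Y P1 P2.
have AB : A - B = c * (h + h) by rewrite /c divfK//; lra.
have : 0 <= X + Y - 2 * c * (A - B) + (h + h) * c ^+ 2 by lra.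
rewrite AB => H.
have -> : (c * (h + h)) ^+ 2 = (h + h) * (c ^+ 2 * (h + h)) by ring.
by rewrite ler_pM2l; lra.
Qed.

End IntervalIntegrals.

(** * The operator on sums of pulses *)

Section ComplexIntegral.
Context {R : realType}.
Implicit Types (f g : R -> R[i]).
Notation mu := (@lebesgue_measure R).
Notation Re := complex.Re.
Notation Im := complex.Im.

Lemma cReD (z w : R[i]) : Re (z + w) = Re z + Re w.
Proof. by case: z w => ? ? []. Qed.
Lemma cImD (z w : R[i]) : Im (z + w) = Im z + Im w.
Proof. by case: z w => ? ? []. Qed.
Lemma cReM (z w : R[i]) : Re (z * w) = Re z * Re w - Im z * Im w.
Proof. by case: z w => ? ? []. Qed.
Lemma cImM (z w : R[i]) : Im (z * w) = Re z * Im w + Im z * Re w.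
Proof. by case: z w => ? ? []. Qed.
Lemma complex_ext (z w : R[i]) : Re z = Re w -> Im z = Im w -> z = w.
Proof. by case: z w => ? ? [? ?] /= -> ->. Qed.

Lemma sqr_normc_ReIm (z : R[i]) : Normc.normc z ^+ 2 = Re z ^+ 2 + Im z ^+ 2.
Proof. by case: z => a b /=; rewrite sqr_sqrtr ?addr_ge0 ?sqr_ge0. Qed.

Lemma normc_ge0 (z : R[i]) : 0 <= Normc.normc z.
Proof. by case: z => a b /=; exact: sqrtr_ge0. Qed.

Lemma abs_Re_le (z : R[i]) : `|Re z| <= Normc.normc z.
Proof.
rewrite -(@ler_pXn2r _ 2)// ?nnegrE ?normc_ge0//.
by rewrite sqr_normc_ReIm real_normK ?num_real// lerDl sqr_ge0.
Qed.

Lemma abs_Im_le (z : R[i]) : `|Im z| <= Normc.normc z.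
Proof.
rewrite -(@ler_pXn2r _ 2)// ?nnegrE ?normc_ge0//.
by rewrite sqr_normc_ReIm real_normK ?num_real// lerDr sqr_ge0.
Qed.

(** [cintegral] is total; this relation adds that the integral converges, which
    makes it linear. *)
Definition has_cintegral f v :=
  [/\ mu.-integrable Rpos (EFin \o (fun x => Re (f x))),
      mu.-integrable Rpos (EFin \o (fun x => Im (f x))) & cintegral f = v].

Lemma measurable_Rpos : measurable (@Rpos R).
Proof. exact: measurable_itv. Qed.
Hint Resolve measurable_Rpos : core.

Lemma integrable_lin (u v : R -> R) a b :
  mu.-integrable Rpos (EFin \o u) -> mu.-integrable Rpos (EFin \o v) ->
  mu.-integrable Rpos (EFin \o (fun x => a * u x + b * v x)) /\
  \int[mu]_(x in Rpos) (a * u x + b * v x) =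
    a * \int[mu]_(x in Rpos) u x + b * \int[mu]_(x in Rpos) v x.
Proof.
move=> iu iv.
have iau : mu.-integrable Rpos (EFin \o (fun x => a * u x)).
  by rewrite (_ : _ \o _ = (fun x => a%:E * (u x)%:E)%E)//; exact: integrableZl.
have ibv : mu.-integrable Rpos (EFin \o (fun x => b * v x)).
  by rewrite (_ : _ \o _ = (fun x => b%:E * (v x)%:E)%E)//; exact: integrableZl.
split; last by rewrite RintegralD// !RintegralZl.
rewrite (_ : _ \o _ = ((EFin \o (fun x => a * u x)%R) \+
  (EFin \o (fun x => b * v x)%R))%E)//.
exact: integrableD.
Qed.

Lemma has_cintegral_lin (c : R[i]) f g v w :
  has_cintegral f v -> has_cintegral g w ->
  has_cintegral (fun x => c * f x + g x) (c * v + w).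
Proof.
move=> [fr fi <-] [gr gi <-].
have [r1 e1] := integrable_lin (Re c) (- Im c) fr fi.
have [r2 e2] := integrable_lin 1 1 r1 gr.
have [i1 e3] := integrable_lin (Re c) (Im c) fi fr.
have [i2 e4] := integrable_lin 1 1 i1 gi.
have E1 : (fun x => Re (c * f x + g x)) =
    (fun x => 1 * (Re c * Re (f x) + - Im c * Im (f x)) + 1 * Re (g x)).
  by apply/funext => x; rewrite cReD cReM !mul1r mulNr.
have E2 : (fun x => Im (c * f x + g x)) =
    (fun x => 1 * (Re c * Im (f x) + Im c * Re (f x)) + 1 * Im (g x)).
  by apply/funext => x; rewrite cImD cImM !mul1r.
split; [by rewrite E1|by rewrite E2|].
rewrite /cintegral E1 E2 e2 e1 e4 e3 !mul1r.
by apply: complex_ext; rewrite ?cReD ?cImD ?cReM ?cImM/= ?mulNr.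
Qed.

Lemma has_cintegral0 : has_cintegral (fun=> 0) 0.
Proof.
have i0 : mu.-integrable Rpos (EFin \o (fun=> 0 : R)) by exact: integrable0.
split => //=; rewrite /cintegral /=.
have -> : \int[mu]_(x in Rpos) (0:R) = 0 by rewrite /Rintegral integral0.
by [].
Qed.

Lemma has_cintegral_sum (I : eqType) (r : seq I) (a : I -> R[i])
    (F : I -> R -> R[i]) (v : I -> R[i]) :
  (forall i, has_cintegral (F i) (v i)) ->
  has_cintegral (fun x => \sum_(i <- r) a i * F i x) (\sum_(i <- r) a i * v i).
Proof.
move=> H; elim: r => [|i r IH].
  rewrite big_nil (_ : (fun x => _) = fun=> 0); first exact: has_cintegral0.
  by apply/funext => x; rewrite big_nil.
rewrite big_cons (_ : (fun x => _) =
  fun x => a i * F i x + \sum_(j <- r) a j * F j x).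
  exact: has_cintegral_lin.
by apply/funext => x; rewrite big_cons.
Qed.

Definition outer_pulse p h : R -> R :=
  fun y => \1_`[p, p + h] y - \1_`[p + 3 * h, p + 4 * h] y.

Lemma Rpos_itv (s t : R) : 0 < s -> `[s, t] `<=` (@Rpos R).
Proof.
move=> s0 x; rewrite /Rpos /= !in_itv/= andbT => /andP[sx _].
exact: lt_le_trans sx.
Qed.

Lemma integral_mul_indic (w : R -> R) s t : continuous_pos w -> 0 < s ->
  mu.-integrable Rpos (EFin \o (fun y => w y * \1_`[s, t] y)) /\
  \int[mu]_(y in Rpos) (w y * \1_`[s, t] y) = itvint w s t.
Proof.
move=> cw s0.
have E : (fun y => w y * \1_`[s, t] y) = (w \_ `[s, t]).
  by apply/funext => y; rewrite patchE indicE; case: (y \in _); rewrite ?mulr1 ?mulr0.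
rewrite E; split; last first.
  rewrite -Rintegral_mkcondr; congr (Rintegral _ _ _).
  by apply/setIidr; exact: Rpos_itv.
rewrite -restrict_EFin; apply/integrable_restrict => //.
rewrite (setIidr (Rpos_itv s0)); exact: continuous_pos_integrable.
Qed.

Lemma integral_outer_pulse (w : R -> R) p h : continuous_pos w -> 0 < p -> 0 < h ->
  mu.-integrable Rpos (EFin \o (fun y => w y * outer_pulse p h y)) /\
  \int[mu]_(y in Rpos) (w y * outer_pulse p h y) =
    itvint w p (p + h) - itvint w (p + 3 * h) (p + 4 * h).
Proof.
move=> cw p0 h0.
have p3 : 0 < p + 3 * h by lra.
have [i1 e1] := integral_mul_indic (p + h) cw p0.
have [i2 e2] := integral_mul_indic (p + 4 * h) cw p3.
have [i3 e3] := integrable_lin 1 (-1) i1 i2.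
rewrite (_ : (fun y => w y * outer_pulse p h y) = (fun y =>
  1 * (w y * \1_`[p, p + h] y) + -1 * (w y * \1_`[p + 3 * h, p + 4 * h] y))).
  by split => //; rewrite e3 e1 e2 mul1r mulN1r.
by apply/funext => y; rewrite /outer_pulse; ring.
Qed.

Lemma continuous_pos_max (u : R -> R) x : continuous_pos u ->
  continuous_pos (fun y => u (Num.max x y)).
Proof.
move=> cu y y0; apply: (@continuous_comp _ _ _ (fun y => Num.max x y) u).
  by apply: continuous_max; [exact: cvg_cst|exact: cvg_id].
by apply: cu; rewrite lt_max y0 orbT.
Qed.

Lemma itvint_max_ge (u : R -> R) x s t : s <= t -> t <= x ->
  itvint (fun y => u (Num.max x y)) s t = (t - s) * u x.
Proof.
move=> st tx; rewrite -itvint_cst//; apply: eq_Rintegral => y.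
rewrite inE/= in_itv/= => /andP[_ yt].
by rewrite (max_idPl _)// (le_trans yt).
Qed.

Lemma itvint_max_le (u : R -> R) x s t : x <= s ->
  itvint (fun y => u (Num.max x y)) s t = itvint u s t.
Proof.
move=> xs; apply: eq_Rintegral => y; rewrite inE/= in_itv/= => /andP[sy _].
by rewrite (max_idPr _)// (le_trans xs).
Qed.

Section Pulses.
Variables (psi : R -> R[i]) (n : nat) (p : 'I_n -> R) (h : R) (a : 'I_n -> R[i]).
Hypothesis cRe : continuous_pos (fun x => Re (psi x)).
Hypothesis cIm : continuous_pos (fun x => Im (psi x)).
Hypothesis h0 : 0 < h.
Hypothesis p0 : forall i, 0 < p i.
Hypothesis psep : forall i j, i != j -> p i + 4 * h < p j \/ p j + 4 * h < p i.

Definition pulse_sum : R -> R[i] :=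
  fun y => \sum_(j < n) a j * (outer_pulse (p j) h y)%:C%C.

Let bump (u : R -> R) x q := itvint (fun y => u (Num.max x y)) q (q + h) -
  itvint (fun y => u (Num.max x y)) (q + 3 * h) (q + 4 * h).

Let Qop_pulse_sumE x : Qop psi pulse_sum x =
  \sum_(j < n) a j * Complex (bump (fun z => Re (psi z)) x (p j))
                             (bump (fun z => Im (psi z)) x (p j)).
Proof.
rewrite /Qop.
have -> : (fun y => psi (Num.max x y) * pulse_sum y) = (fun y =>
    \sum_(j < n) a j * (psi (Num.max x y) * (outer_pulse (p j) h y)%:C%C)).
  apply/funext => y; rewrite /pulse_sum mulr_sumr; apply: eq_bigr => j _.
  by rewrite mulrCA.
have [//|_ _] := @has_cintegral_sum _ (index_enum _) a
  (fun j y => psi (Num.max x y) * (outer_pulse (p j) h y)%:C%C)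
  (fun j => Complex (bump (fun z => Re (psi z)) x (p j))
                    (bump (fun z => Im (psi z)) x (p j))); last by [].
move=> j.
have [ir er] := integral_outer_pulse (continuous_pos_max (x:=x) cRe) (p0 j) h0.
have [ii ei] := integral_outer_pulse (continuous_pos_max (x:=x) cIm) (p0 j) h0.
have Er : (fun y => Re (psi (Num.max x y) * (outer_pulse (p j) h y)%:C%C)) =
    fun y => Re (psi (Num.max x y)) * outer_pulse (p j) h y.
  by apply/funext => y; rewrite cReM/= mulr0 subr0.
have Ei : (fun y => Im (psi (Num.max x y) * (outer_pulse (p j) h y)%:C%C)) =
    fun y => Im (psi (Num.max x y)) * outer_pulse (p j) h y.
  by apply/funext => y; rewrite cImM/= mulr0 add0r.
split; [by rewrite Er|by rewrite Ei|].
by rewrite /cintegral Er Ei er ei.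
Qed.

Let bump_const (u : R -> R) i j : exists k, forall x,
  p i + h <= x <= p i + 3 * h -> bump u x (p j) = (if i == j then h else 0) * u x + k.
Proof.
have [<-|ij] := eqVneq i j.
  exists (- itvint u (p i + 3 * h) (p i + 4 * h)) => x /andP[x1 x2].
  by rewrite /bump itvint_max_ge ?itvint_max_le//; lra.
case: (psep ij) => pij.
  exists (itvint u (p j) (p j + h) - itvint u (p j + 3 * h) (p j + 4 * h)).
  by move=> x /andP[x1 x2]; rewrite /bump !itvint_max_le; lra.
exists 0 => x /andP[x1 x2]; rewrite /bump !itvint_max_ge; lra.
Qed.

(** A pulse far to the left of [x] is paired with the constant [psi x], which its
    mean zero kills; one far to the right is paired with [psi] itself, which
    gives a number independent of [x]; for the pulse of the cell of [x], the
    first quarter is of the first kind and the last quarter of the second. *)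
Lemma Qop_pulse_sum i : exists K : R[i], forall x, p i + h <= x <= p i + 3 * h ->
  Qop psi pulse_sum x = a i * h%:C%C * psi x + K.
Proof.
have [kr krE] := choice (bump_const (fun x => Re (psi x)) i).
have [ki kiE] := choice (bump_const (fun x => Im (psi x)) i).
exists (\sum_(j < n) a j * Complex (kr j) (ki j)) => x xi.
rewrite Qop_pulse_sumE.
have E j : Complex (bump (fun z => Re (psi z)) x (p j))
      (bump (fun z => Im (psi z)) x (p j)) =
    (if i == j then h else 0)%:C%C * psi x + Complex (kr j) (ki j).
  by apply: complex_ext; rewrite ?cReD ?cImD ?cReM ?cImM/= ?(krE j x)// ?(kiE j x)//;
    ring.
under eq_bigr do rewrite E mulrDr.
rewrite big_split/=; congr (_ + _).
rewrite (bigD1 i)//= eqxx big1 ?addr0 ?mulrA// => j ji.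
rewrite eq_sym (negbTE ji).
by rewrite (_ : 0%:C%C = 0 :> R[i])// mul0r mulr0.
Qed.

End Pulses.

End ComplexIntegral.

(** * Square integrable functions and finite rank operators *)

Section SquareIntegrable.
Context {R : realType}.
Implicit Types (f g : R -> R[i]).
Notation mu := (@lebesgue_measure R).
Notation Re := complex.Re.
Notation Im := complex.Im.
Let mRpos := @measurable_Rpos R.
Hint Resolve mRpos : core.

Definition sqint f : \bar R :=
  (\int[mu]_(x in Rpos) (Normc.normc (f x) ^+ 2)%:E)%E.

Lemma sqint_ge0 f : (0 <= sqint f)%E.
Proof. by apply: integral_ge0 => x _; rewrite lee_fin sqr_ge0. Qed.

Lemma L2normE f : L2norm f = sqrte (sqint f).
Proof.
rewrite /L2norm unlock -poweR12_sqrt ?sqint_ge0//; congr (_ `^ _)%E.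
rewrite /sqint [RHS]integral_mkcond; apply: eq_integral => x _.
rewrite !patchE; case: ifP => _ /=.
  rewrite powR_mulrn ?normr_ge0// ger0_norm ?normc_ge0//.
by rewrite normr0 powR0.
Qed.

Lemma L2norm_le1 f : (sqint f <= 1)%E -> (L2norm f <= 1)%E.
Proof.
rewrite L2normE; move: (sqint_ge0 f); case: (sqint f) => [r|//|//] r0.
by rewrite /= !lee_fin => r1; rewrite -[leRHS]sqrtr1; exact: ler_wsqrtr.
Qed.

Lemma L2norm_ge k f : 0 <= k -> ((k ^+ 2)%:E <= sqint f)%E -> (k%:E <= L2norm f)%E.
Proof.
rewrite L2normE => k0; case: (sqint f) => [r||//]; last by move=> _; rewrite /= leey.
by rewrite /= !lee_fin => r1; rewrite -(ger0_norm k0) -sqrtr_sqr; exact: ler_wsqrtr.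
Qed.

Lemma L2norm_ltpinfty f : (L2norm f < +oo)%E = (sqint f < +oo)%E.
Proof.
rewrite L2normE; move: (sqint_ge0 f); case: (sqint f) => [r||]//= _.
by rewrite !ltey.
Qed.

Lemma cmeasurable_sqr_normc f (D : set R) : D `<=` Rpos -> measurable D ->
  cmeasurable f ->
  measurable_fun D (fun x : R => (Normc.normc (f x) ^+ 2)%:E : \bar R).
Proof.
move=> DR mD [mr mi]; apply: measurable_funS DR _ => //.
apply/measurable_EFinP.
rewrite (_ : (fun x => _) = fun x => Re (f x) ^+ 2 + Im (f x) ^+ 2); last first.
  by apply/funext => x; rewrite sqr_normc_ReIm.
by apply: measurable_funD; exact: measurable_funX.
Qed.

Lemma cmeasurable_lin (c : R[i]) f g : cmeasurable f -> cmeasurable g ->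
  cmeasurable (fun x => c * f x + g x).
Proof.
move=> [fr fi] [gr gi]; split.
  rewrite (_ : (fun x => _) =
    fun x => (Re c * Re (f x) - Im c * Im (f x)) + Re (g x)); last first.
    by apply/funext => x; rewrite cReD cReM.
  apply: measurable_funD => //.
  by apply: measurable_funB; apply: measurable_funM => //; exact: measurable_cst.
rewrite (_ : (fun x => _) =
  fun x => (Re c * Im (f x) + Im c * Re (f x)) + Im (g x)); last first.
  by apply/funext => x; rewrite cImD cImM.
apply: measurable_funD => //.
by apply: measurable_funD; apply: measurable_funM => //; exact: measurable_cst.
Qed.

Lemma L2_0 : L2 (fun=> 0 : R[i]).
Proof.
split; first by split; exact: measurable_cst.
rewrite L2norm_ltpinfty /sqint.
by rewrite (eq_integral (fun=> 0%E)) ?integral0// => x _; rewrite Normc.normc0 expr0n.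
Qed.

Lemma sqr_normc_lin (c z w : R[i]) : Normc.normc (c * z + w) ^+ 2 <=
  2 * Normc.normc c ^+ 2 * Normc.normc z ^+ 2 + 2 * Normc.normc w ^+ 2.
Proof.
rewrite -mulrA -exprMn -Normc.normcM; move: (c * z) => {}z.
rewrite !sqr_normc_ReIm cReD cImD.
have H (a b : R) : (a + b) ^+ 2 <= 2 * a ^+ 2 + 2 * b ^+ 2.
  rewrite -subr_ge0; have -> : 2 * a ^+ 2 + 2 * b ^+ 2 - (a + b) ^+ 2 = (a - b) ^+ 2.
    by ring.
  exact: sqr_ge0.
by have := H (Re z) (Re w); have := H (Im z) (Im w); lra.
Qed.

Lemma L2_lin (c : R[i]) f g : L2 f -> L2 g -> L2 (fun x => c * f x + g x).
Proof.
move=> [mf ff] [mg fg]; split; first exact: cmeasurable_lin.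
move: ff fg; rewrite !L2norm_ltpinfty => ff fg.
have nf := cmeasurable_sqr_normc (@subset_refl _ _) mRpos mf.
have ng := cmeasurable_sqr_normc (@subset_refl _ _) mRpos mg.
pose k := 2 * Normc.normc c ^+ 2.
have k0 : 0 <= k by rewrite mulr_ge0// sqr_ge0.
apply: (@le_lt_trans _ _ (k%:E * sqint f + 2%:E * sqint g)%E); last first.
  by rewrite lte_add_pinfty// lte_mul_pinfty.
rewrite /sqint -ge0_integralZl_EFin//; last by move=> x _; rewrite lee_fin sqr_ge0.
rewrite -ge0_integralZl_EFin//; last by move=> x _; rewrite lee_fin sqr_ge0.
rewrite -ge0_integralD//.
- apply: ge0_le_integral => //.
  + by move=> x _; rewrite lee_fin sqr_ge0.
  + exact: cmeasurable_sqr_normc (cmeasurable_lin _ _ _).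
  + by apply: emeasurable_funD; exact: measurable_funeM.
  + by move=> x _; rewrite -!EFinM -EFinD lee_fin; exact: sqr_normc_lin.
- by move=> x _; rewrite -!EFinM lee_fin mulr_ge0 ?sqr_ge0.
- exact: measurable_funeM.
- by move=> x _; rewrite -!EFinM lee_fin mulr_ge0 ?sqr_ge0.
- exact: measurable_funeM.
Qed.

Lemma L2_sum (I : eqType) (r : seq I) (a : I -> R[i]) (F : I -> R -> R[i]) :
  (forall i, L2 (F i)) -> L2 (fun x => \sum_(i <- r) a i * F i x).
Proof.
move=> H; elim: r => [|i r IH].
  rewrite (_ : (fun x => _) = fun=> 0); first exact: L2_0.
  by apply/funext => x; rewrite big_nil.
rewrite (_ : (fun x => _) = fun x => a i * F i x + \sum_(j <- r) a j * F j x).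
  exact: L2_lin.
by apply/funext => x; rewrite big_cons.
Qed.

Lemma bounded_operator_sum S (I : eqType) (r : seq I) (a : I -> R[i])
    (F : I -> R -> R[i]) : bounded_operator S -> (forall i, L2 (F i)) ->
  ae_eq_pos (S (fun x => \sum_(i <- r) a i * F i x))
            (fun x => \sum_(i <- r) a i * S (F i) x).
Proof.
move=> [_ lin _] LF; elim: r => [|i r IH].
  (* Linearity at 0, 0 with coefficient 1 says that S 0 = S 0 + S 0. *)
  have := lin 1 _ _ L2_0 L2_0.
  have -> : (fun x : R => 1 * 0 + 0 : R[i]) = fun=> 0.
    by apply/funext => x; rewrite mulr0 addr0.
  have -> : (fun x => \sum_(i <- [::]) a i * F i x) = fun=> 0.
    by apply/funext => x; rewrite big_nil.
  apply: filterS => x /= H /H E; rewrite big_nil.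
  by apply/(addrI (S (fun=> 0) x)); rewrite addr0 {3}E mul1r.
have := lin (a i) _ _ (LF i) (L2_sum r a LF).
have -> : (fun x => \sum_(j <- i :: r) a j * F j x) =
    fun x => a i * F i x + \sum_(j <- r) a j * F j x.
  by apply/funext => x; rewrite big_cons.
apply: filterS2 IH => x /= IH E px.
by rewrite big_cons E// IH.
Qed.

(** The [n.+1] images lie in an [n]-dimensional space, hence are linearly
    dependent.  The coefficients of a relation can be rescaled freely, so their
    square norm can be prescribed. *)
Lemma rank_le_kernel n S (F : 'I_n.+1 -> R -> R[i]) (N : R) :
  bounded_operator S -> rank_le n S -> (forall j, L2 (F j)) -> 0 < N ->
  exists2 a : 'I_n.+1 -> R[i], \sum_j Normc.normc (a j) ^+ 2 = N &
    ae_eq_pos (S (fun x => \sum_j a j * F j x)) (fun=> 0).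
Proof.
move=> bS [g gL2 gS] LF N0.
have [c cE] := choice (fun j => gS _ (LF j)).
(* A row vector in the left kernel of the coefficient matrix is a relation. *)
pose C := \matrix_(j < n.+1, k < n) c j k.
have : kermx C != 0.
  rewrite kermx_eq0 /row_free; apply/eqP => rC.
  by have := rank_leq_col C; rewrite rC ltnn.
move=> /rowV0Pn[v /sub_kermxP vC v0].
pose M := \sum_j Normc.normc (v 0 j) ^+ 2.
have M0 : 0 < M.
  rewrite lt_def sumr_ge0 ?andbT; last by move=> j _; exact: sqr_ge0.
  apply: contra_neq v0 => /psumr_eq0P z.
  apply/rowP => j; rewrite mxE; apply: Normc.eq0_normc.
  by apply/eqP; rewrite -sqrf_eq0 z// => k _; exact: sqr_ge0.
pose t := Num.sqrt (N / M).
exists (fun j => t%:C%C * v 0 j).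
  under eq_bigr do rewrite Normc.normcM exprMn.
  rewrite -mulr_sumr -/M sqr_normc_ReIm/= expr0n addr0 sqr_sqrtr ?divfK ?gt_eqF//.
  by rewrite divr_ge0// ltW.
have H := @bounded_operator_sum S _ (index_enum _) (fun j => t%:C%C * v 0 j) F bS LF.
have {}cE : \forall x \ae mu, forall j, Rpos x -> S (F j) x = \sum_(k < n) c j k * g k x.
  by apply: filter_forall => j; exact: (cE j).
apply: filterS2 H cE => x /= E1 E2 px.
rewrite E1//; under eq_bigr do rewrite E2// mulr_sumr.
rewrite exchange_big big1//= => k _.
transitivity (t%:C%C * (v *m C) 0 k * g k x); last first.
  by rewrite vC mxE mulr0 mul0r.
rewrite mxE mulr_sumr mulr_suml; apply: eq_bigr => j _.
by rewrite mxE !mulrA.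
Qed.

End SquareIntegrable.

(** * Norms of sums of pulses *)

Section PulseNorms.
Context {R : realType}.
Implicit Types (f g : R -> R[i]).
Notation mu := (@lebesgue_measure R).
Notation Re := complex.Re.
Notation Im := complex.Im.
Let mRpos := @measurable_Rpos R.
Hint Resolve mRpos : core.

Lemma itvint_lin (u v : R -> R) (al be ga s t : R) :
  continuous_pos u -> continuous_pos v -> 0 < s -> s <= t ->
  itvint (fun x => al * u x + be * v x + ga) s t =
    al * itvint u s t + be * itvint v s t + (t - s) * ga.
Proof.
move=> cu cv s0 st.
have cZ (w : R -> R) (k : R) : continuous_pos w -> continuous_pos (fun x => k * w x).
  by move=> cw x x0; apply: continuousM; [exact: cvg_cst|exact: cw].
have cau := cZ _ al cu; have cbv := cZ _ be cv.
have cs : continuous_pos (fun x => al * u x + be * v x).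
  by move=> x x0; apply: (@continuousD _ _ _ (fun x => al * u x) (fun x => be * v x));
    [exact: cau|exact: cbv].
have cg : continuous_pos (fun=> ga) by move=> x x0; exact: cvg_cst.
have i w : continuous_pos w -> mu.-integrable `[s, t] (EFin \o w).
  by move=> cw; exact: continuous_pos_integrable.
rewrite -[(t - s) * ga]itvint_cst// /itvint.
by rewrite (RintegralD _ (i _ cs) (i _ cg))// (RintegralD _ (i _ cau) (i _ cbv))//
  (RintegralZl _ _ (i _ cu))// (RintegralZl _ _ (i _ cv)).
Qed.

Lemma outer_pulse_out (p h y : R) : 0 < h -> ~~ (p <= y <= p + 4 * h) ->
  outer_pulse p h y = 0.
Proof.
move=> h0 yp; rewrite /outer_pulse !indicE !memNset ?subrr//=; rewrite in_itv/=;
  apply: contraNnot yp => /andP[y1 y2]; apply/andP; split; lra.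
Qed.

Lemma sqr_outer_pulse (p h y : R) : 0 < h -> outer_pulse p h y ^+ 2 =
  \1_`[p, p + h] y + \1_`[p + 3 * h, p + 4 * h] y.
Proof.
move=> h0; rewrite /outer_pulse !indicE.
have [yA|_] := boolP (y \in `[p, p + h]%classic); last first.
  by case: (_ \in _) => /=; ring.
rewrite memNset; first by rewrite mulr1n mulr0n; ring.
move: yA; rewrite inE/= !in_itv/= => /andP[_ y1] /andP[y2 _]; lra.
Qed.

(** This is minus the second difference, with step [h], of a primitive of [u]. *)
Definition second_difference (u : R -> R) h q :=
  itvint u (q + h) (q + h + h) - itvint u (q + h + h) (q + h + h + h).

Section Pulses.
Variables (n : nat) (p : 'I_n -> R) (h : R).
Hypothesis h0 : 0 < h.
Hypothesis p0 : forall i, 0 < p i.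
Hypothesis psep : forall i j, i != j -> p i + 4 * h < p j \/ p j + 4 * h < p i.

Lemma cmeasurable_pulse_sum a : cmeasurable (pulse_sum p h a).
Proof.
have m (j : 'I_n) (c : R) : measurable_fun Rpos (fun y => c * outer_pulse (p j) h y).
  apply: measurable_funM; first exact: measurable_cst.
  by apply: measurable_funB; apply: measurable_indic; exact: measurable_itv.
split.
  rewrite (_ : (fun x => _) = fun x => \sum_j Re (a j) * outer_pulse (p j) h x).
    exact: measurable_sum.
  apply/funext => x; rewrite /pulse_sum.
  rewrite (big_morph (@complex.Re R) (@cReD R) (erefl : Re 0 = 0)); apply: eq_bigr => j _.
  by rewrite cReM/= mulr0 subr0.
rewrite (_ : (fun x => _) = fun x => \sum_j Im (a j) * outer_pulse (p j) h x).
  exact: measurable_sum.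
apply/funext => x; rewrite /pulse_sum.
rewrite (big_morph (@complex.Im R) (@cImD R) (erefl : Im 0 = 0)); apply: eq_bigr => j _.
by rewrite cImM/= mulr0 add0r.
Qed.

(** The pulses have disjoint supports, so there are no cross terms. *)
Lemma sqr_normc_pulse_sum a y : Normc.normc (pulse_sum p h a y) ^+ 2 =
  \sum_j Normc.normc (a j) ^+ 2 *
    (\1_`[p j, p j + h] y + \1_`[p j + 3 * h, p j + 4 * h] y).
Proof.
under eq_bigr do rewrite -sqr_outer_pulse//.
have [[j yj]|nj] := pselect (exists j, p j <= y <= p j + 4 * h).
  have o i : i != j -> outer_pulse (p i) h y = 0.
    move=> ij; apply: outer_pulse_out => //; apply/negP => yi.
    by case: (psep ij) => ?; lra.
  rewrite /pulse_sum (bigD1 j)//= big1 ?addr0; last first.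
    by move=> i /o ->; rewrite (_ : 0%:C%C = 0 :> R[i])// mulr0.
  rewrite (bigD1 j)//= big1 ?addr0; last first.
    by move=> i /o ->; rewrite expr0n mulr0.
  by rewrite Normc.normcM exprMn [X in _ * X]sqr_normc_ReIm/= expr0n addr0.
have o i : outer_pulse (p i) h y = 0.
  by apply: outer_pulse_out => //; apply/negP => yi; apply: nj; exists i.
rewrite /pulse_sum !big1.
- by rewrite Normc.normc0 expr0n.
- by move=> i _; rewrite o expr0n mulr0.
- by move=> i _; rewrite o (_ : 0%:C%C = 0 :> R[i])// mulr0.
Qed.

Lemma sqint_pulse_sum a : sqint (pulse_sum p h a) =
  ((\sum_j Normc.normc (a j) ^+ 2) * (2 * h))%:E.
Proof.
rewrite /sqint; under eq_integral do rewrite sqr_normc_pulse_sum -sumEFin.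
have m (j : 'I_n) : measurable_fun Rpos (fun y : R => (Normc.normc (a j) ^+ 2 *
    (\1_`[p j, p j + h] y + \1_`[p j + 3 * h, p j + 4 * h] y))%:E : \bar R).
  apply/measurable_EFinP; apply: measurable_funM; first exact: measurable_cst.
  by apply: measurable_funD; apply: measurable_indic; exact: measurable_itv.
rewrite ge0_integral_sum//; last first.
  by move=> i y _; rewrite lee_fin mulr_ge0 ?sqr_ge0// addr_ge0.
rewrite mulr_suml -sumEFin; apply: eq_bigr => j _.
set c := Normc.normc (a j) ^+ 2.
have cc : continuous_pos (fun=> 1 : R) by move=> x _; exact: cvg_cst.
have p3 : 0 < p j + 3 * h by rewrite addr_gt0// mulr_gt0.
have [i1 e1] := integral_mul_indic (p j + h) cc (p0 j).
have [i2 e2] := integral_mul_indic (p j + 4 * h) cc p3.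
have [i3 e3] := integrable_lin c c i1 i2.
have E : (fun y => c * (1 * \1_`[p j, p j + h] y) +
    c * (1 * \1_`[p j + 3 * h, p j + 4 * h] y)) =
    (fun y => c * (\1_`[p j, p j + h] y + \1_`[p j + 3 * h, p j + 4 * h] y)).
  by apply/funext => y; rewrite !mul1r mulrDr.
rewrite {}E in i3 e3.
transitivity (EFin (\int[mu]_(y in Rpos) (c * (\1_`[p j, p j + h] y +
   \1_`[p j + 3 * h, p j + 4 * h] y)))).
  by rewrite /Rintegral fineK//; exact: integrable_fin_num i3.
have H1 : p j <= p j + h by rewrite lerDl ltW.
have H2 : p j + 3 * h <= p j + 4 * h by rewrite lerD2l ler_pM2r// ler_nat.
rewrite e3 e1 e2 (itvint_cst _ H1) (itvint_cst _ H2).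
congr EFin; ring.
Qed.

Lemma L2_pulse_sum a : L2 (pulse_sum p h a).
Proof.
split; first exact: cmeasurable_pulse_sum.
by rewrite L2norm_ltpinfty sqint_pulse_sum ltry.
Qed.

Lemma pulse_sum_bounded_compactly_supported a :
  bounded_compactly_supported (pulse_sum p h a).
Proof.
split.
  exists (Num.sqrt (\sum_j Normc.normc (a j) ^+ 2 * 2)) => y _.
  rewrite -[leLHS]ger0_norm ?normc_ge0// -sqrtr_sqr ler_wsqrtr//.
  rewrite sqr_normc_pulse_sum; apply: ler_sum => j _.
  rewrite ler_wpM2l ?sqr_ge0// -[leRHS]/(1 + 1) lerD// indicE;
    by case: (_ \in _).
exists (\big[setU/set0]_(j < n) `[p j, p j + 4 * h]%classic); split.
- elim/big_ind: _ => //; first exact: compact0.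
    exact: compactU.
  by move=> j _; exact: segment_compact.
- move=> y; rewrite -bigcup_seq => -[j _].
  exact: Rpos_itv.
- move=> y _ yK; rewrite /pulse_sum big1// => j _.
  rewrite outer_pulse_out//; first by rewrite (_ : 0%:C%C = 0 :> R[i])// mulr0.
  apply/negP => yj; apply: yK; rewrite -bigcup_seq.
  by exists j; rewrite /= ?mem_index_enum// in_itv.
Qed.

End Pulses.
End PulseNorms.

(** * A lower bound for singular numbers *)

Section SingularNumbers.
Context {R : realType}.
Notation mu := (@lebesgue_measure R).
Notation Re := complex.Re.
Notation Im := complex.Im.
Let mRpos := @measurable_Rpos R.
Hint Resolve mRpos : core.

Lemma second_difference_lin (u v : R -> R) (al be ga h q : R) :
  continuous_pos u -> continuous_pos v -> 0 < q -> 0 < h ->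
  second_difference (fun x => al * u x + be * v x + ga) h q =
    al * second_difference u h q + be * second_difference v h q.
Proof.
move=> cu cv q0 h0; rewrite /second_difference.
have q1 : 0 < q + h by lra.
have q2 : 0 < q + h + h by lra.
have q3 : q + h <= q + h + h by lra.
have q4 : q + h + h <= q + h + h + h by lra.
rewrite (itvint_lin _ _ _ cu cv q1 q3) (itvint_lin _ _ _ cu cv q2 q4); ring.
Qed.

Definition complex_second_difference (psi : R -> R[i]) h q : R[i] := Complex
  (second_difference (fun x => Re (psi x)) h q)
  (second_difference (fun x => Im (psi x)) h q).

Variable psi : R -> R[i].
Hypothesis cRe : continuous_pos (fun x => Re (psi x)).
Hypothesis cIm : continuous_pos (fun x => Im (psi x)).

(** Testing against the inner pulse kills the constant [K], so only the second
    difference of [psi] survives. *)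
Lemma sqint_affine_ge (z K : R[i]) (q h : R) : 0 < q -> 0 < h ->
  (((Normc.normc z * Normc.normc (complex_second_difference psi h q)) ^+ 2 / (2 * h))%:E <=
  \int[mu]_(x in `[(q + h)%R, (q + h + h + h)%R])
     (Normc.normc (z * psi x + K)%R ^+ 2)%:E)%E.
Proof.
move=> q0 h0.
have c0 : 0 < q + h by lra.
have c1 : 0 < q + h + h by lra.
pose v1 x := Re z * Re (psi x) + (- Im z) * Im (psi x) + Re K.
pose v2 x := Re z * Im (psi x) + Im z * Re (psi x) + Im K.
have clin (u v : R -> R) (al be ga : R) : continuous_pos u -> continuous_pos v ->
    continuous_pos (fun x => al * u x + be * v x + ga).
  move=> cu cv x x0; apply: (@continuousD _ _ _ (fun x => al * u x + be * v x)
    (fun=> ga)); last exact: cvg_cst.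
  apply: (@continuousD _ _ _ (fun x => al * u x) (fun x => be * v x)).
    by apply: continuousM; [exact: cvg_cst|exact: cu].
  by apply: continuousM; [exact: cvg_cst|exact: cv].
have cv1 : continuous_pos v1 by exact: clin.
have cv2 : continuous_pos v2 by exact: clin.
have csq (w : R -> R) : continuous_pos w -> continuous_pos (fun x => w x ^+ 2).
  by move=> cw x x0; apply: continuousM; exact: cw.
have i1 : mu.-integrable `[q + h, q + h + h + h] (EFin \o (fun x => v1 x ^+ 2)).
  exact: continuous_pos_integrable _ (csq _ cv1) c0.
have i2 : mu.-integrable `[q + h, q + h + h + h] (EFin \o (fun x => v2 x ^+ 2)).
  exact: continuous_pos_integrable _ (csq _ cv2) c0.
have -> : (\int[mu]_(x in `[(q + h)%R, (q + h + h + h)%R])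
     (Normc.normc (z * psi x + K) ^+ 2)%:E)%E =
   (itvint (fun x => v1 x ^+ 2) (q + h) (q + h + h + h) +
    itvint (fun x => v2 x ^+ 2) (q + h) (q + h + h + h))%:E.
  rewrite /itvint -(RintegralD _ i1 i2)// /Rintegral fineK; last first.
    apply: integrable_fin_num => //.
    apply: (continuous_pos_integrable _ _ c0) => x x0.
    apply: (@continuousD _ _ _ (fun x => v1 x ^+ 2) (fun x => v2 x ^+ 2)).
      exact: csq cv1 _ x0.
    exact: csq cv2 _ x0.
  apply: eq_integral => x _; congr EFin.
  by rewrite sqr_normc_ReIm cReD cImD cReM cImM /v1 /v2 mulNr.
have := sqr_half_difference_le cv1 c0 h0.
rewrite -/(second_difference v1 h q) second_difference_lin// => I1.
have := sqr_half_difference_le cv2 c0 h0.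
rewrite -/(second_difference v2 h q) second_difference_lin// => I2.
rewrite lee_fin ler_pdivrMr ?mulr_gt0//.
rewrite exprMn !sqr_normc_ReIm/=.
move: I1 I2; set D1 := second_difference _ _ _; set D2 := second_difference _ _ _.
have -> : (Re z ^+ 2 + Im z ^+ 2) * (D1 ^+ 2 + D2 ^+ 2) =
    (Re z * D1 + - Im z * D2) ^+ 2 + (Re z * D2 + Im z * D1) ^+ 2 by ring.
lra.
Qed.

Lemma continuous_pos_measurable (u : R -> R) : continuous_pos u -> measurable_fun Rpos u.
Proof.
move=> cu; apply: open_continuous_measurable_fun; first exact: interval_open.
by move=> x; rewrite inE /Rpos/= in_itv/= andbT => /cu.
Qed.

Lemma continuous_pos_cmeasurable : cmeasurable psi.
Proof. by split; exact: continuous_pos_measurable. Qed.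

Lemma cmeasurable_cst (K : R[i]) : cmeasurable (fun=> K : R[i]).
Proof. by split; exact: measurable_cst. Qed.

(** If [S] has rank at most [n], it kills a combination [f] of the [n.+1] outer
    pulses, so that [(T - S) f = Q f].  On the middle half of cell [i] this is
    [a i * h * psi] plus a constant, whose square norm is at least
    [2 * h * k ^+ 2] times that of [a i]; summing over the cells gives the
    bound, as the square norm of [f] is [2 * h] times that of [a]. *)
Lemma singular_number_ge T n (p : 'I_n.+1 -> R) (h k : R) :
  bounded_operator T -> Q_extends_to psi T -> 0 < h -> 0 <= k ->
  (forall i, 0 < p i) ->
  (forall i j, i != j -> p i + 4 * h < p j \/ p j + 4 * h < p i) ->
  (forall i, 2 * k <= Normc.normc (complex_second_difference psi h (p i))) ->
  (k%:E <= singular_number T n)%E.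
Proof.
move=> bT QT h0 k0 p0 psep Dk.
apply/ereal_infP => _ [S [bS rS] <-].
pose F j (y : R) : R[i] := (outer_pulse (p j) h y)%:C%C.
have LF j : L2 (F j).
  have := L2_pulse_sum h0 p0 psep (fun i => (i == j)%:R).
  congr L2; apply/funext => y; rewrite /pulse_sum (bigD1 j)//= eqxx mul1r.
  by rewrite big1 ?addr0// => i /negbTE ->; rewrite mul0r.
have N0 : 0 < (2 * h)^-1 by rewrite invr_gt0 mulr_gt0.
have [a aN Sa] := rank_le_kernel bS rS LF N0.
pose f := pulse_sum p h a.
have Lf : L2 f by exact: L2_pulse_sum.
have f1 : (L2norm f <= 1)%E.
  apply: L2norm_le1; rewrite sqint_pulse_sum// aN mulVf//.
  by rewrite mulf_neq0 ?gt_eqF.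
pose H x := T f x - S f x.
suff : (k%:E <= L2norm H)%E.
  by move=> /le_trans; apply; apply: ereal_sup_ubound; exists f.
have mH : cmeasurable H.
  have [bT1 _ _] := bT; have [bS1 _ _] := bS.
  have [mT _] := bT1 _ Lf; have [mS _] := bS1 _ Lf.
  have := cmeasurable_lin (-1) mS mT.
  by congr cmeasurable; apply/funext => x; rewrite /H mulN1r addrC.
have HQ : ae_eq_pos H (Qop psi f).
  have := QT f (cmeasurable_pulse_sum _ _ _)
    (pulse_sum_bounded_compactly_supported h0 p0 psep a).
  apply: filterS2 Sa => x /= E1 E2 px.
  by rewrite /H E2// /f /pulse_sum -/F E1// subr0.
apply: L2norm_ge => //.
pose M i := `[p i + h, p i + h + h + h]%classic.
have MR i : M i `<=` Rpos by apply: Rpos_itv; rewrite addr_gt0.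
have low i : ((2 * h * k ^+ 2 * Normc.normc (a i) ^+ 2)%:E <=
    \int[mu]_(x in M i) (Normc.normc (H x) ^+ 2)%:E)%E.
  have [K KE] := Qop_pulse_sum a cRe cIm h0 p0 psep i.
  have le1 := sqint_affine_ge (a i * h%:C%C) K (p0 i) h0.
  have -> : (\int[mu]_(x in M i) (Normc.normc (H x) ^+ 2)%:E =
      \int[mu]_(x in M i) (Normc.normc (a i * h%:C%C * psi x + K)%R ^+ 2)%:E)%E.
    apply: ae_eq_integral => //.
    - exact: measurable_itv.
    - by apply: cmeasurable_sqr_normc => //; exact: measurable_itv.
    - have mk := cmeasurable_lin (a i * h%:C%C) continuous_pos_cmeasurable (cmeasurable_cst K).
      apply: (@cmeasurable_sqr_normc _ _ (M i) _ _ mk) => //.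
      exact: measurable_itv.
    - apply: filterS HQ => x HQ xM; rewrite HQ; last exact: MR xM.
      rewrite /f KE//; move: xM; rewrite /M /= in_itv/= => /andP[x1 x2].
      by rewrite x1/=; lra.
  apply: le_trans le1; rewrite lee_fin Normc.normcM.
  rewrite (_ : Normc.normc h%:C%C = h); last first.
    by rewrite /= expr0n addr0 sqrtr_sqr gtr0_norm.
  rewrite ler_pdivlMr ?mulr_gt0//.
  set na := Normc.normc (a i).
  have -> : 2 * h * k ^+ 2 * na ^+ 2 * (2 * h) = (na * h * (2 * k)) ^+ 2 by ring.
  have na0 : 0 <= na * h by rewrite mulr_ge0 ?normc_ge0// ltW.
  rewrite ler_pXn2r ?nnegrE//; first exact: ler_wpM2l.
    by apply: mulr_ge0 => //; apply: mulr_ge0.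
  by rewrite mulr_ge0 ?normc_ge0.
have mHs (D : set R) := @cmeasurable_sqr_normc R H D.
have tM : trivIset [set` index_enum 'I_n.+1] M.
  move=> i j _ _ [x []]; rewrite /M/= !in_itv/= => /andP[i1 i2] /andP[j1 j2].
  apply: contrapT => /eqP /psep; case; lra.
have mU : measurable (\big[setU/set0]_(i < n.+1) M i).
  by apply: bigsetU_measurable => i _; exact: measurable_itv.
have UR : \big[setU/set0]_(i < n.+1) M i `<=` Rpos.
  by rewrite -bigcup_seq => x [i _]; exact: MR.
apply: (@le_trans _ _ (\int[mu]_(x in \big[setU/set0]_(i < n.+1) M i)
    (Normc.normc (H x) ^+ 2)%:E)%E); last first.
  by apply: ge0_subset_integral => // [|x _]; [exact: mHs|rewrite lee_fin sqr_ge0].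
rewrite ge0_integral_bigsetU//; first last.
- by move=> x _; rewrite lee_fin sqr_ge0.
- exact: mHs.
- exact: index_enum_uniq.
- by move=> i; exact: measurable_itv.
apply: (@le_trans _ _ (\sum_(i < n.+1) (2 * h * k ^+ 2 * Normc.normc (a i) ^+ 2)%:E)%E).
  rewrite sumEFin -mulr_sumr aN lee_fin mulrAC mulfV ?mul1r//.
  by rewrite mulf_neq0 ?gt_eqF.
by apply: lee_sum => i _; exact: low.
Qed.
End SingularNumbers.

(** * Decay of singular numbers and rigidity of the symbol *)

Section Decay.
Context {R : realType}.

(** The terms of index from [N] to [n] are all at least [Num.sqrt k], so [n.+1 - N]
    times that number is bounded by the tail of the series from [N] on; and
    [n.+1 - N] is at least half of [n.+1] when [n >= 2 N]. *)
Lemma sqrt_summable_decay (s : nat -> \bar R) (e : R) :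
  (\sum_(0 <= n <oo) (s n `^ 2^-1) < +oo)%E -> 0 < e ->
  exists N, forall n k, (N <= n)%N -> 0 <= k ->
    (forall j, (j <= n)%N -> (k%:E <= s j)%E) -> n.+1%:R * Num.sqrt k <= e.
Proof.
move=> ssum e0.
have nn j : predT j -> (0 <= s j `^ 2^-1)%E by move=> _; exact: poweR_ge0.
have e2 : 0 < e / 2 by rewrite divr_gt0.
have /fine_cvgP[fin tl] := nneseries_tail_cvg ssum nn.
have [N _ HN] : \forall N \near \oo,
    (\sum_(N <= j <oo) s j `^ 2^-1 <= (e / 2)%:E)%E.
  apply: filterS2 fin (cvgr_lt _ tl _ e2) => m finm /ltW.
  by rewrite -lee_fin /= fineK.
exists N.*2 => n k Nn k0 kS.
have {}HN := HN N (leqnn N).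
have NSn : (N <= n.+1)%N by rewrite (leq_trans _ (leqW Nn))// -addnn leq_addr.
have : ((n.+1 - N)%:R * Num.sqrt k <= e / 2).
  rewrite -lee_fin; apply: le_trans HN.
  apply: (@le_trans _ _ (\sum_(N <= j < n.+1) s j `^ 2^-1)%E); last first.
    by apply: nneseries_lim_ge => j _ _; exact: poweR_ge0.
  apply: (@le_trans _ _ (\sum_(N <= j < n.+1) (Num.sqrt k)%:E)%E).
    by rewrite sumEFin lee_fin sumr_const_nat mulr_natl.
  rewrite big_nat_cond [leRHS]big_nat_cond; apply: lee_sum => j.
  rewrite andbT ltnS => /andP[_ jn].
  rewrite -powR12_sqrt// -poweR_EFin.
  apply: gt0_ler_poweR; rewrite ?invr_ge0// ?in_itv/= ?leey ?andbT ?lee_fin//.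
    by apply: le_trans (kS _ jn); rewrite lee_fin.
  exact: kS.
have : (n.+1%:R : R) <= 2 * (n.+1 - N)%:R.
  by rewrite -natrM ler_nat; lia.
have := sqrtr_ge0 k; nra.
Qed.
End Decay.

Section Constancy.
Context {R : realType}.
Notation mu := (@lebesgue_measure R).

Definition real_locally_ac (u : R -> R) :=
  forall a b : R, 0 < a -> a < b -> forall e, 0 < e -> exists2 d : R, 0 < d &
    forall (n : nat) (s t : 'I_n -> R),
      (forall i, [/\ a <= s i, s i <= t i & t i <= b]) ->
      trivIset [set: 'I_n] (fun i => `]s i, t i[%classic) ->
      \sum_(i < n) (t i - s i) < d ->
      \sum_(i < n) `|u (t i) - u (s i)| < e.

Lemma itvint_near (u : R -> R) (s h c e : R) : continuous_pos u -> 0 < s -> 0 < h ->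
  (forall y, s <= y <= s + h -> `|u y - c| <= e) ->
  `|itvint u s (s + h) - h * c| <= h * e.
Proof.
move=> cu s0 h0 H.
have cc (k : R) : continuous_pos (fun=> k) by move=> x _; exact: cvg_cst.
have sh : s <= s + h by rewrite lerDl ltW.
have ic k := continuous_pos_integrable (s + h) (cc k) s0.
have iu := continuous_pos_integrable (s + h) cu s0.
have E k : itvint (fun=> k) s (s + h) = h * k.
  by rewrite itvint_cst// addrAC subrr add0r.
have L1 : h * (c - e) <= itvint u s (s + h).
  rewrite -E; apply: le_Rintegral => //.
  by move=> x /=; rewrite in_itv/= => /H; rewrite ler_distl => /andP[].
have L2 : itvint u s (s + h) <= h * (c + e).
  rewrite -E; apply: le_Rintegral => //.
  by move=> x /=; rewrite in_itv/= => /H; rewrite ler_distl => /andP[].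
by rewrite ler_distl -mulrBr -mulrDr L1.
Qed.

(** This turns a second difference into an increment of [u], to which absolute
    continuity applies. *)
Lemma second_difference_increment (u : R -> R) (q h : R) :
  continuous_pos u -> 0 < h -> 0 < q ->
  exists2 x, q + h < x < q + h + h &
    `|second_difference u h q| = h * `|u (x + h) - u x|.
Proof.
move=> cu h0 q0.
have q1 : 0 < q + h by rewrite addr_gt0.
have q2 : q + h < q + h + h by rewrite ltrDl.
have [x xq E] := itvint_increment cu h0 q1 q2.
exists x => //; rewrite /second_difference -normrN opprB E.
by rewrite [X in X * _]addrAC subrr add0r normrM gtr0_norm.
Qed.

Lemma residue_gap m (i j : nat) : i = j %[mod m] -> (i < j)%N -> (i + m <= j)%N.
Proof.
move=> /esym/eqP ij lt; rewrite eqn_mod_dvd ?(ltnW lt)// in ij.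
rewrite -leq_subRL ?(ltnW lt)//; apply: dvdn_leq => //.
by rewrite subn_gt0.
Qed.

Section Rigidity.
(* [u] stands for the real or the imaginary part of the symbol and [s] for the
   singular numbers. *)
Variables (u : R -> R) (s : nat -> \bar R).
Hypothesis cu : continuous_pos u.
Hypothesis uac : real_locally_ac u.
Hypothesis ssum : (\sum_(0 <= n <oo) (s n `^ 2^-1) < +oo)%E.
Hypothesis slow : forall n (p : 'I_n.+1 -> R) (h k : R), 0 < h -> 0 <= k ->
  (forall i, 0 < p i) ->
  (forall i j, i != j -> p i + 4 * h < p j \/ p j + 4 * h < p i) ->
  (forall i, 2 * k <= `|second_difference u h (p i)|) -> (k%:E <= s n)%E.

(** If many cells are bad, then all the first singular numbers are at least
    [eps * h ^+ 2], against the decay: the cells of index at most [j] bound the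
    [j]-th number. *)
Lemma few_large_second_differences (eps d : R) : 0 < eps -> 0 < d ->
  exists2 h1, 0 < h1 & forall n (p : 'I_n -> R) h, 0 < h -> h < h1 ->
  (forall i, 0 < p i) ->
  (forall i j, i != j -> p i + 4 * h < p j \/ p j + 4 * h < p i) ->
  (forall i, 2 * (eps * h ^+ 2) <= `|second_difference u h (p i)|) ->
  n%:R * h < d.
Proof.
move=> eps0 d0.
have e0 : 0 < Num.sqrt eps * (d / 2) by rewrite mulr_gt0 ?sqrtr_gt0// divr_gt0.
have [N HN] := sqrt_summable_decay ssum e0.
exists (d / N.+1%:R); first by rewrite divr_gt0.
move=> n p h h0 hh1 p0 psep pbig.
have hN : N.+1%:R * h < d by rewrite mulrC -ltr_pdivlMr.
have [nN|] := leqP n N.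
  apply: le_lt_trans hN; rewrite ler_pM2r// ler_nat; lia.
case: n p p0 psep pbig => // n p p0 psep pbig; rewrite ltnS => Nn.
have k0 : 0 <= eps * h ^+ 2 by rewrite mulr_ge0 ?sqr_ge0 ?ltW.
have := HN n (eps * h ^+ 2) Nn k0.
rewrite (sqrtrM _ (ltW eps0)) sqrtr_sqr gtr0_norm// [n.+1%:R * _]mulrCA ler_pM2l ?sqrtr_gt0//.
move=> H; apply: (@le_lt_trans _ _ (d / 2)); last by lra.
apply: H => j jn.
have w (i : 'I_j.+1) : (i < n.+1)%N by have := ltn_ord i; lia.
apply: (slow (p := fun i => p (Ordinal (w i))) h0 k0) => //.
by move=> i i' ii'; apply: psep; apply: contra_neq ii' => -[/val_inj].
Qed.

(** Telescoping over a fine mesh from [a] to [b].  Cells that start at consecutive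
    mesh points overlap, so the bad ones are sorted by the residue of their
    index modulo 5; cells of length [4 * h] in one residue class are separated,
    by a gap of length at least [h]. *)
Lemma ac_rigidity a b : 0 < a -> a < b -> u a = u b.
Proof.
move=> a0 ab.
pose L := b - a.
have L0 : 0 < L by rewrite subr_gt0.
suff H e : 0 < e -> `|u a - u b| <= 9 * e.
  apply/eqP; rewrite -subr_eq0 -normr_le0; apply/ler_addgt0Pr => e e0.
  rewrite add0r; have := H (e / 9); rewrite divr_gt0// => /(_ isT).
  by rewrite mulrC divfK.
move=> e0.
(* The last cells stick out beyond [b] by less than 4 * L. *)
have aB : a < b + 4 * L by lra.
have [d d0 Hd] := uac a0 aB e0.
have ac1 x y : a <= x -> x <= y -> y <= b + 4 * L -> y - x < d -> `|u y - u x| < e.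
  move=> ax xy yb xyd.
  have := Hd 1%N (fun=> x) (fun=> y).
  by rewrite !big_ord1; apply => // i j _ _ _; rewrite !ord1.
pose eps := e / L.
have eps0 : 0 < eps by rewrite divr_gt0.
have [h1 h10 Hh1] := few_large_second_differences eps0 d0.
(* The mesh size must be below [h1], for the bad cells to be few, and below
   [d / 2], for [u] to vary by less than [e] over two mesh steps. *)
have [M M_gt0 HM] : exists2 M : nat, (0 < M)%N & L / M%:R < Num.min h1 (d / 2).
  have m0 : 0 < Num.min h1 (d / 2) by rewrite lt_min h10 divr_gt0.
  exists (Num.truncn (L / Num.min h1 (d / 2))).+1 => //.
  rewrite ltr_pdivrMr// mulrC -ltr_pdivrMr//.
  exact: truncnS_gt.
pose h := L / M%:R.
have M1 : (1 : R) <= M%:R by rewrite ler1n.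
have h0 : 0 < h by rewrite divr_gt0// ltr0n.
have Mh : M%:R * h = L by rewrite /h mulrC divfK// pnatr_eq0 -lt0n.
have hL : h <= L by rewrite -Mh ler_pMl.
move: HM; rewrite -/h lt_min => /andP[hh1 hd2].
pose q (j : nat) := a + j%:R * h.
have q0 j : 0 < q j by rewrite ltr_wpDr// mulr_ge0// ltW.
have qa j : a <= q j by rewrite lerDl mulr_ge0// ltW.
have qS j : q j + h = q j.+1 by rewrite /q -addrA -natr1 mulrDl mul1r.
have qb (j : 'I_M) : q j + h <= b.
  rewrite qS /q; have : j.+1%:R * h <= L by rewrite -Mh ler_pM2r// ler_nat.
  rewrite /L; lra.
have qsep (i j : nat) : (i + 5 <= j)%N -> q i + 4 * h < q j.
  rewrite -(ler_nat R) natrD /q => ij.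
  have : (i%:R + 5) * h <= j%:R * h by rewrite ler_pM2r.
  rewrite mulrDl; lra.
pose D j := second_difference u h (q j).
pose bad (j : 'I_M) := 2 * (eps * h ^+ 2) <= `|D j|.
have good (j : 'I_M) : ~~ bad j -> `|D j| <= 2 * (eps * h ^+ 2).
  by rewrite /bad -ltNge => /ltW.
have badsum (r : 'I_5) : \sum_(j < M | bad j && (inord (j %% 5) == r)) `|D j| <= h * e.
  pose B := [pred j : 'I_M | bad j && (inord (j %% 5) == r)].
  pose p (i : 'I_#|B|) := q (enum_val i).
  have sep (i i' : 'I_#|B|) : i != i' ->
      p i + 4 * h < p i' \/ p i' + 4 * h < p i.
    move=> ii'.
    have := enum_valP i; have := enum_valP i'; rewrite !inE.
    move=> /andP[_ /eqP r1] /andP[_ /eqP r2].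
    have mm : (enum_val i = enum_val i' %[mod 5])%N.
      have := congr1 val (etrans r2 (esym r1)).
      by rewrite /= !inordK// ltn_mod.
    have ne : (enum_val i : nat) != enum_val i'.
      by apply: contra_neq ii' => /val_inj/enum_val_inj.
    have [lt|gt] := ltnP (enum_val i) (enum_val i').
      by left; apply/qsep/residue_gap.
    right; apply/qsep/residue_gap; first exact: esym.
    by rewrite ltn_neqAle eq_sym ne.
  have Bd : #|B|%:R * h < d.
    apply: (Hh1 _ p) => // i; first exact: q0.
    by have := enum_valP i; rewrite inE => /andP[].
  have [x xE] := choice (fun i => let: ex_intro2 x P Q :=
    second_difference_increment cu h0 (q0 (enum_val i : 'I_M) : 0 < p i) in
    ex_intro (fun x => p i + h < x < p i + h + h /\ _ = _) x (conj P Q)).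
  have -> : \sum_(j < M | bad j && (inord (j %% 5) == r)) `|D j| =
     h * \sum_i `|u (x i + h) - u (x i)|.
    rewrite mulr_sumr.
    under [RHS]eq_bigr do rewrite -(xE _).2.
    rewrite -(big_enum_val (fun j : 'I_M => `|D j|)).
    by apply: eq_bigl => j; rewrite inE.
  rewrite ler_pM2l//; apply/ltW/Hd.
  - move=> i; have [/andP[x1 x2] _] := xE i.
    have := qb (enum_val i); have := qa (enum_val i); rewrite -/(p i) => *.
    by split; lra.
  - move=> i i' _ _ [y []]; rewrite /= !in_itv/= => /andP[y1 y2] /andP[y3 y4].
    apply: contrapT => /eqP/sep.
    have [/andP[x1 x2] _] := xE i; have [/andP[x3 x4] _] := xE i'.
    case; lra.
  - under eq_bigr do rewrite addrAC subrr add0r.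
    by rewrite sumr_const card_ord -mulr_natl.
have total : \sum_(j < M) `|D j| <= 7 * (h * e).
  rewrite (bigID bad)/=.
  have G : \sum_(j < M | ~~ bad j) `|D j| <= 2 * (h * e).
    apply: (@le_trans _ _ (\sum_(j < M) 2 * (eps * h ^+ 2))); last first.
      have -> : 2 * (h * e) = M%:R * (2 * (eps * h ^+ 2)).
        have -> : e = eps * L by rewrite /eps divfK ?gt_eqF.
        by rewrite -Mh; ring.
      by rewrite sumr_const card_ord [leRHS]mulr_natl.
    rewrite big_mkcond; apply: ler_sum => j _; case: ifP => [/good//|_].
    by apply: mulr_ge0 => //; apply: mulr_ge0; [exact: ltW|exact: sqr_ge0].
  have B : \sum_(j < M | bad j) `|D j| <= 5 * (h * e).
    rewrite (partition_big (fun j : 'I_M => inord (j %% 5) : 'I_5) predT)//=.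
    apply: (@le_trans _ _ (\sum_(r < 5) h * e)); first exact: ler_sum.
    by rewrite sumr_const card_ord [leRHS]mulr_natl.
  by lra.
have tele : `|itvint u (a + h) (a + h + h) - itvint u (b + h) (b + h + h)| <=
    7 * (h * e).
  apply: le_trans total; rewrite -normrN opprB.
  pose W (j : nat) := itvint u (q j.+1) (q j.+1 + h).
  have -> : itvint u (b + h) (b + h + h) - itvint u (a + h) (a + h + h) = W M - W 0%N.
    by rewrite /W -!qS /q Mh mul0r addr0 /L addrCA subrr addr0.
  rewrite -telescope_sumr// big_mkord; apply: le_trans (ler_norm_sum _ _ _) _.
  apply: ler_sum => j _; rewrite -normrN opprB.
  by rewrite /W /D /second_difference -!qS.
(* The two ends of the telescoped sum are [h * u a] and [h * u b], up to
   [h * e] each. *)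
have na : `|itvint u (a + h) (a + h + h) - h * u a| <= h * e.
  apply: itvint_near => //; first lra.
  by move=> y /andP[y1 y2]; apply/ltW/ac1; lra.
have nb : `|itvint u (b + h) (b + h + h) - h * u b| <= h * e.
  apply: itvint_near => //; first lra.
  by move=> y /andP[y1 y2]; apply/ltW/ac1; lra.
rewrite -(ler_pM2l h0) -[X in X * _ <= _](gtr0_norm h0) -normrM.
move: tele na nb; rewrite mulrBr !ler_norml.
move=> /andP[? ?] /andP[? ?] /andP[? ?]; apply/andP; split; lra.
Qed.

End Rigidity.
End Constancy.

(** * Constant symbols *)

Section ConstantSymbol.
Context {R : realType}.
Notation mu := (@lebesgue_measure R).
Notation Re := complex.Re.
Notation Im := complex.Im.
Variable psi : R -> R[i].

Lemma real_locally_ac_continuous_pos (u : R -> R) : real_locally_ac u -> continuous_pos u.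
Proof.
move=> uac x x0; apply/cvgrPdist_lt => e e0.
have x2 : 0 < x / 2 by rewrite divr_gt0.
have ab : x / 2 < x + 1 by lra.
have [d d0 Hd] := uac _ _ x2 ab e e0.
have ac1 s t : x / 2 <= s -> s <= t -> t <= x + 1 -> t - s < d -> `|u t - u s| < e.
  move=> xs st tx std; have := Hd 1%N (fun=> s) (fun=> t).
  by rewrite !big_ord1; apply => // i j _ _ _; rewrite !ord1.
have m0 : 0 < Num.min d (Num.min (x / 2) 1) by rewrite !lt_min d0 x2/=.
exists (Num.min d (Num.min (x / 2) 1)) => //= y; rewrite /ball_/=.
rewrite !lt_min => /andP[yd /andP[yx y1]].
rewrite ltr_distl in yd; rewrite ltr_distl in yx; rewrite ltr_distl in y1.
move: yd yx y1 => /andP[d1 d2] /andP[d3 d4] /andP[d5 d6].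
have [xy|yx] := leP x y; first by rewrite distrC; apply: ac1; lra.
by apply: ac1; lra.
Qed.

Hypothesis psi_ac : locally_abs_continuous psi.

Lemma locally_ac_proj (P : R[i] -> R) :
  (forall z w, P z - P w = P (z - w)) -> (forall z, `|P z| <= Normc.normc z) ->
  real_locally_ac (fun x => P (psi x)).
Proof.
move=> PB Pn a b a0 ab e e0; have [d d0 Hd] := psi_ac a0 ab e0.
exists d => // n s t H1 H2 H3; apply: le_lt_trans (Hd n s t H1 H2 H3).
by apply: ler_sum => i _; rewrite PB.
Qed.

Lemma locally_ac_Re : real_locally_ac (fun x => Re (psi x)).
Proof. by apply: locally_ac_proj abs_Re_le => -[? ?] []. Qed.

Lemma locally_ac_Im : real_locally_ac (fun x => Im (psi x)).
Proof. by apply: locally_ac_proj abs_Im_le => -[? ?] []. Qed.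

Lemma psi_constant a b : Q_in_Schatten 2^-1 psi -> 0 < a -> a < b -> psi a = psi b.
Proof.
move=> [T QT [bT Tsum]] a0 ab.
have cr := real_locally_ac_continuous_pos locally_ac_Re.
have ci := real_locally_ac_continuous_pos locally_ac_Im.
apply: complex_ext.
  apply: (ac_rigidity cr locally_ac_Re Tsum) => // n p h k h0 k0 p0 psep pk.
  apply: (singular_number_ge cr ci bT QT h0 k0 p0 psep) => i.
  by apply: le_trans (pk i) _; exact: (abs_Re_le (Complex _ _)).
apply: (ac_rigidity ci locally_ac_Im Tsum) => // n p h k h0 k0 p0 psep pk.
apply: (singular_number_ge cr ci bT QT h0 k0 p0 psep) => i.
by apply: le_trans (pk i) _; exact: (abs_Im_le (Complex _ _)).
Qed.

(** The operator sends the indicator of the segment from 1 to 2 to the constant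
    [c], which has infinite norm on the half-line unless it vanishes. *)
Lemma bounded_constant_eq0 T (c : R[i]) : bounded_operator T ->
  Q_extends_to psi T -> (forall x, 0 < x -> psi x = c) -> c = 0.
Proof.
move=> [TL2 _ _] QT psic.
pose f (y : R) : R[i] := (\1_`[1, 2] y)%:C%C.
have mf : cmeasurable f.
  split; last exact: measurable_cst.
  by apply: measurable_indic; exact: measurable_itv.
have bf : bounded_compactly_supported f.
  split.
    exists 1 => y _; rewrite /f /= expr0n addr0 sqrtr_sqr indicE.
    by case: (_ \in _); rewrite ?normr1 ?normr0.
  exists `[1, 2]%classic; split; first exact: segment_compact.
    exact: Rpos_itv.
  by move=> y _ y12; rewrite /f indicE memNset.
have cc (k : R) : continuous_pos (fun=> k) by move=> x _; exact: cvg_cst.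
have I (k : R) : \int[mu]_(y in Rpos) (k * \1_`[1, 2] y) = k.
  have [_ ->] := integral_mul_indic 2 (cc k) ltr01.
  by rewrite itvint_cst ?ler1n// (_ : 2 - 1 = 1 :> R) ?mul1r//; ring.
have Lf : L2 f.
  split=> //; rewrite L2norm_ltpinfty /sqint.
  have [i1 _] := integral_mul_indic 2 (cc 1) ltr01.
  rewrite (_ : (fun x => _) = EFin \o (fun y : R => 1 * \1_`[1, 2] y)).
    rewrite ltey_eq; apply/orP; left; apply: integrable_fin_num i1.
    exact: measurable_Rpos.
  apply/funext => y /=; rewrite expr0n addr0 sqrtr_sqr real_normK ?num_real//.
  by rewrite indicE mul1r; case: (_ \in _); rewrite ?expr1n ?expr0n.
have Qc x : 0 < x -> Qop psi f x = c.
  move=> x0; rewrite /Qop /cintegral.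
  have E y : y \in (@Rpos R) -> psi (Num.max x y) * f y = c * f y.
    by rewrite inE /Rpos/= in_itv/= andbT => y0; rewrite psic// lt_max x0.
  apply: complex_ext => /=.
    rewrite -[RHS](I (Re c)); apply: eq_Rintegral => y.
    by move=> /E ->; rewrite cReM /= mulr0 subr0.
  rewrite -[RHS](I (Im c)); apply: eq_Rintegral => y.
  by move=> /E ->; rewrite cImM /= mulr0 add0r.
have [mT] := TL2 _ Lf; rewrite L2norm_ltpinfty.
have -> : sqint (T f) = (\int[mu]_(x in Rpos) (cst (Normc.normc c ^+ 2)%:E) x)%E.
  apply: ae_eq_integral.
  - exact: measurable_Rpos.
  - by apply: cmeasurable_sqr_normc => //; exact: measurable_Rpos.
  - exact: measurable_cst.
  - apply: filterS (QT f mf bf) => x H px; rewrite H// Qc//.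
    by move: px; rewrite /Rpos/= in_itv/= andbT.
rewrite integral_cst//; last exact: measurable_Rpos.
rewrite /Rpos/= lebesgue_measure_itv/= ltry addye//.
move=> fin; apply: Normc.eq0_normc; apply/eqP; apply: contraTT fin => c0.
rewrite -leNgt gt0_muley// lte_fin.
by rewrite exprn_even_gt0.
Qed.

End ConstantSymbol.

Theorem corollary8p8 (R : realType) (psi : R -> R[i])
  (psi_ac : locally_abs_continuous psi)
  (Q_half : Q_in_Schatten (2^-1) psi) :
  forall x : R, 0 < x -> psi x = 0.
Proof.
have psic y : 0 < y -> psi y = psi 1.
  move=> y0; have [y1|y1|->//] := ltgtP y 1.
    exact: psi_constant.
  by symmetry; exact: psi_constant.
have [T QT [bT _]] := Q_half.
move=> x x0; rewrite psic//.
exact: (bounded_constant_eq0 bT QT psic).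
Qed.
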